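(* Let $R$ be a commutative ring with identity. (a) Let $M$ be a cyclic $R$-module. If $M$ is a morphic $R$-module in the sense of Nicholson and Sánchez Campos, then $M$ is a quasi morphic $R$-module. (b) Let $M$ be a cocyclic $R$-module which satisfies the double annihilator conditions ($DAC$). If $M$ is a morphic $R$-module in the sense of Nicholson and Sánchez Campos, then $M$ is a quasi comorphic $R$-module.
   Context: An $R$-module $M$ is morphic in the sense of Nicholson and Sánchez Campos if $M/f(M)\cong \ker f$ for every $R$-endomorphism $f$ of $M$. For $a\in R$, $(0:_Ma)=\{m\in M: am=0\}$; for an ideal $I$ of $R$, $(0:_MI)=\{m\in M: Im=0\}$; for a submodule $N$ of $M$, $(N:_RM)=\{r\in R: rM\subseteq N\}$; $\mathrm{Ann}_R(X)$ denotes the annihilator in $R$ of $X$. $M$ is cocyclic if it has a simple essential socle. $M$ satisfies the $DAC$ if $I=\mathrm{Ann}_R((0:_MI))$ for each ideal $I$ of $R$. A proper submodule $N$ of $M$ is completely irreducible if whenever $N=\bigcap_{i\in I}N_i$ for a family $\{N_i\}_{i\in I}$ of submodules of $M$, then $N=N_i$ for some $i\in I$. $M$ is quasi morphic if for each $a\in R$, $(0:_Ma)$ is a cyclic submodule of $M$ and $\mathrm{Ann}_R((0:_Ma))=Ra+\mathrm{Ann}_R(M)$. $M$ is quasi comorphic if for each $a\in R$, $aM$ is a completely irreducible submodule of $M$ and $(aM:_RM)=Ra+\mathrm{Ann}_R(M)$.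
   Formalization: In the definition of quasi comorphic, aM is required to be completely irreducible only when aM ≠ M; literally, completely irreducible submodules are proper while 1M = M, so no module would be quasi comorphic and (b) would fail, e.g. for R = M a field. *)

(* Defs.v *)
From HB Require Import structures.
From mathcomp Require Import all_boot all_algebra.
From mathcomp Require Import generic_quotient ring_quotient.
From mathcomp Require Import boolp classical_sets.

Set Implicit Arguments.
Unset Strict Implicit.
Unset Printing Implicit Defensive.

Import GRing.Theory.

Local Open Scope ring_scope.
Local Open Scope quotient_scope.
Local Open Scope classical_set_scope.

(* The quotient M / N. The library provides the additive group [Quotient.quot N]
   only; the scalar action r *: \pi x = \pi (r *: x) is added here. *)
Section QuotientModule.
Context {R : comPzRingType} {M : lmodType R} (N : submodClosed M).

(* [submodClosed] does not inherit from [zmodClosed], which the library's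
   quotient requires. *)
Definition zmod_pred : {pred M} := fun x => x \in N.

Lemma zmod_pred_closed : zmod_closed zmod_pred.
Proof. exact: GRing.submod_closedB (submodClosedP N). Qed.

HB.instance Definition _ := GRing.isZmodClosed.Build M zmod_pred
  zmod_pred_closed.

Definition quotmod := Quotient.quot zmod_pred.

HB.instance Definition _ := GRing.Zmodule.on quotmod.

Let pi_ (x : M) : quotmod := \pi_(Quotient.quot zmod_pred) x.

Definition quotmod_scale (r : R) (u : quotmod) : quotmod :=
  pi_ (r *: repr (u : Quotient.quot zmod_pred)).

Lemma quotmod_scale_pi r x : quotmod_scale r (pi_ x) = pi_ (r *: x).
Proof.
apply/eqP; rewrite /quotmod_scale /pi_ -Quotient.idealrBE -scalerBr.
by apply: (rpredZ r); rewrite -[_ \in N]/(_ \in zmod_pred) Quotient.idealrBE reprK.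
Qed.

Let pi_addE x y : pi_ x + pi_ y = pi_ (x + y).
Proof. exact: esym (raddfD _ x y). Qed.

Let pi_ind (P : quotmod -> Prop) : (forall x, P (pi_ x)) -> forall u, P u.
Proof. by move=> Px u; rewrite -[u](reprK (u : Quotient.quot zmod_pred)). Qed.

Lemma quotmod_scaleA r s u :
  quotmod_scale r (quotmod_scale s u) = quotmod_scale (r * s) u.
Proof. by elim/pi_ind: u => x; rewrite !quotmod_scale_pi scalerA. Qed.

Lemma quotmod_scale1 : left_id 1 quotmod_scale.
Proof. by elim/pi_ind=> x; rewrite quotmod_scale_pi scale1r. Qed.

Lemma quotmod_scaleDr : right_distributive quotmod_scale +%R.
Proof.
move=> r; elim/pi_ind=> x; elim/pi_ind=> y.
by rewrite !(pi_addE, quotmod_scale_pi) scalerDr.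
Qed.

Lemma quotmod_scaleDl u : {morph quotmod_scale^~ u : r s / r + s}.
Proof.
by elim/pi_ind: u => x r s; rewrite !quotmod_scale_pi pi_addE scalerDl.
Qed.

HB.instance Definition _ := GRing.Zmodule_isLmodule.Build R quotmod
  quotmod_scaleA quotmod_scale1 quotmod_scaleDr quotmod_scaleDl.

End QuotientModule.

Section Submodule.
Context {R : comPzRingType} {M : lmodType R} (N : submodClosed M).

Definition submod := {x : M | x \in N}.

HB.instance Definition _ := SubChoice.on submod.
HB.instance Definition _ := [SubChoice_isSubLmodule of submod by <:].

End Submodule.

Definition mod_iso (R : comPzRingType) (U V : lmodType R) : Prop :=
  exists g : {linear U -> V}, bijective g.

Section KernelImage.
Context {R : comPzRingType} {U V : lmodType R} (f : {linear U -> V}).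

Definition ker_pred : {pred U} := [pred x | f x == 0].
Definition im_pred : {pred V} := [pred y | y \in range f].

Lemma ker_pred_closed : submod_closed ker_pred.
Proof.
split=> [|r x y]; rewrite !inE ?linear0 // => /eqP fx /eqP fy.
by rewrite linearP fx fy scaler0 addr0.
Qed.

Lemma im_pred_closed : submod_closed im_pred.
Proof.
split=> [|r u v]; rewrite !inE; first by exists 0; rewrite ?linear0.
by move=> [x _ <-] [y _ <-]; exists (r *: x + y); rewrite ?linearP.
Qed.

HB.instance Definition _ := GRing.isSubmodClosed.Build R U ker_pred
  ker_pred_closed.
HB.instance Definition _ := GRing.isSubmodClosed.Build R V im_pred
  im_pred_closed.

End KernelImage.

Section Modules.
Context {R : comPzRingType}.

Definition submodule (M : lmodType R) (N : set M) : Prop :=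
  submod_closed (mem N).

Definition ideal (I : set R) : Prop := @submodule R^o I.

Definition cyclic_span (M : lmodType R) (m : M) : set M :=
  range (fun r : R => r *: m).

Definition cyclic_submodule (M : lmodType R) (N : set M) : Prop :=
  exists m : M, N = cyclic_span m.

Definition cyclic_module (M : lmodType R) : Prop :=
  @cyclic_submodule M setT.

Definition morphic (M : lmodType R) : Prop :=
  forall f : {linear M -> M}, mod_iso (quotmod (im_pred f)) (submod (ker_pred f)).

(* (0 :_M a) *)
Definition colon0_elt (M : lmodType R) (a : R) : set M :=
  [set m | a *: m = 0].

(* (0 :_M I) *)
Definition colon0 (M : lmodType R) (I : set R) : set M :=
  [set m | forall r, I r -> r *: m = 0].

(* (N :_R M) *)
Definition colon (M : lmodType R) (N : set M) : set R :=
  [set r | forall m, N (r *: m)].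

Definition ann (M : lmodType R) (X : set M) : set R :=
  [set r | forall m, X m -> r *: m = 0].

(* aM *)
Definition mul_elt (M : lmodType R) (a : R) : set M :=
  range (fun m : M => a *: m).

(* Ra + Ann_R(M) *)
Definition principal_plus_ann (M : lmodType R) (a : R) : set R :=
  [set x + y | x in range (fun r : R => r * a) & y in ann (@setT M)].

Definition simple_submodule (M : lmodType R) (S : set M) : Prop :=
  [/\ submodule S, S <> [set 0] &
      forall N : set M, submodule N -> N `<=` S -> N = [set 0] \/ N = S].

(* The sum of all simple submodules, i.e. the submodule they generate; it is
   zero when there are none. *)
Definition socle (M : lmodType R) : set M :=
  \bigcap_(N in [set N : set M | submodule N /\
                 forall S, simple_submodule S -> S `<=` N]) N.

Definition essential (M : lmodType R) (E : set M) : Prop :=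
  submodule E /\
  forall N : set M, submodule N -> N <> [set 0] -> E `&` N <> [set 0].

Definition cocyclic (M : lmodType R) : Prop :=
  simple_submodule (@socle M) /\ essential (@socle M).

Definition dac (M : lmodType R) : Prop :=
  forall I : set R, ideal I -> I = ann (@colon0 M I).

Definition completely_irreducible (M : lmodType R) (N : set M) : Prop :=
  [/\ submodule N, N <> setT &
      forall (J : Type) (N_ : J -> set M), (forall j, submodule (N_ j)) ->
        N = \bigcap_j N_ j -> exists j, N = N_ j].

Definition quasi_morphic (M : lmodType R) : Prop :=
  forall a : R, cyclic_submodule (@colon0_elt M a) /\
    ann (@colon0_elt M a) = principal_plus_ann M a.

(* The case aM = M has to be admitted: completely irreducible submodules are
   proper by definition, whereas 1M = M, so that otherwise no module at all
   would be quasi comorphic. *)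
Definition quasi_comorphic (M : lmodType R) : Prop :=
  forall a : R, (@mul_elt M a = setT \/ completely_irreducible (@mul_elt M a)) /\
    colon (@mul_elt M a) = principal_plus_ann M a.

End Modules.

(* Main.v *)
Require Import Defs.
From HB Require Import structures.
From mathcomp Require Import all_boot all_algebra.
From mathcomp Require Import generic_quotient ring_quotient.
From mathcomp Require Import boolp classical_sets.

(** If [M] is morphic, then for [a] in [R] the isomorphism
    [M / aM ~ (0 :_M a)] amounts to an endomorphism [h] of [M] with kernel [aM]
    and image [(0 :_M a)]; hence [Ann (0 :_M a) = (aM :_R M)].  For cyclic
    [M = R m], the element [h m] generates [(0 :_M a)].  For cocyclic [M], every
    submodule strictly containing [aM] has a nonzero image under [h], which
    contains the socle; so an [h]-preimage of a nonzero element of the socle lies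
    in every such submodule but not in [aM], and [aM] is completely irreducible. *)

Set Implicit Arguments.
Unset Strict Implicit.
Unset Printing Implicit Defensive.

Import GRing.Theory.

Local Open Scope ring_scope.
Local Open Scope quotient_scope.
Local Open Scope classical_set_scope.

Section QuotientMap.
Context {R : comPzRingType} {M : lmodType R} (N : submodClosed M).

Definition quotmod_pi (x : M) : quotmod N :=
  \pi_(Quotient.quot (zmod_pred N)) x.

Lemma quotmod_pi_linear : linear quotmod_pi.
Proof.
move=> r x y; rewrite -[r *: quotmod_pi x]/(quotmod_scale r (quotmod_pi x)).
by rewrite quotmod_scale_pi; exact: (raddfD (\pi_(Quotient.quot _))).
Qed.

HB.instance Definition _ :=
  GRing.isLinear.Build R M (quotmod N) *:%R quotmod_pi quotmod_pi_linear.

Lemma quotmod_pi_eq0 x : (quotmod_pi x == 0) = (x \in N).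
Proof.
rewrite -(linear0 quotmod_pi) -[RHS]/(x \in zmod_pred N) -[x in RHS]subr0.
exact/esym/Quotient.idealrBE.
Qed.

Lemma quotmod_pi_surj u : exists x, quotmod_pi x = u.
Proof. by exists (repr (u : Quotient.quot (zmod_pred N))); exact: reprK. Qed.

End QuotientMap.

Section Modules.
Context {R : comPzRingType}.
Implicit Types M : lmodType R.

(** [h] is the composite of the projection onto [M / f(M)], the isomorphism onto [ker f] and the
    inclusion of [ker f] in [M]. *)
Lemma morphic_endo M (f : {linear M -> M}) : morphic M ->
  exists h : {linear M -> M},
    h @^-1` [set 0] = range f /\ range h = f @^-1` [set 0].
Proof.
move=> /(_ f) [g [g' gK g'K]].
exists (val \o (g \o @quotmod_pi _ _ (im_pred f)) : {linear M -> M}); split.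
  apply/seteqP; split=> x /=.
    move=> hx; have /(congr1 g') : g (quotmod_pi (im_pred f) x) = g 0.
      by apply: val_inj; rewrite linear0.
    by rewrite !gK => /eqP; rewrite quotmod_pi_eq0 => /set_mem.
  move=> fx; have /eqP -> : quotmod_pi (im_pred f) x == 0.
    by rewrite quotmod_pi_eq0; apply/mem_set.
  by rewrite linear0.
apply/seteqP; split=> [_ [x _ <-]|y /eqP fy] /=.
  by apply/eqP; exact: (valP (g _)).
(* A preimage of [y] is any representative in [M] of the class that [g] sends to [y]. *)
have [x xE] := quotmod_pi_surj (g' (exist _ y fy : submod (ker_pred f))).
by exists x => //=; rewrite xE g'K.
Qed.

Lemma morphic_scale M (a : R) : morphic M ->
  exists h : {linear M -> M},
    h @^-1` [set 0] = @mul_elt R M a /\ range h = @colon0_elt R M a.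
Proof. by move=> /(morphic_endo (a \*: idfun : {linear M -> M})). Qed.

Lemma ann_range M (h : {linear M -> M}) :
  ann (range h) = colon (h @^-1` [set 0]).
Proof.
apply/seteqP; split=> r rh => [m|_ [m _ <-]].
  by rewrite /= linearZ; apply: rh; exists m.
by rewrite -linearZ; exact: rh.
Qed.

Lemma morphic_ann_colon0_elt M (a : R) : morphic M ->
  ann (@colon0_elt R M a) = colon (@mul_elt R M a).
Proof. by move=> /(morphic_scale a) [h [<- <-]]; exact: ann_range. Qed.

Lemma principal_plus_ann_sub_colon M (a : R) :
  @principal_plus_ann R M a `<=` colon (@mul_elt R M a).
Proof.
move=> _ [_ [r _ <-]] [s sM <-] m; exists (r *: m) => //.
by rewrite scalerDl (sM m) // addr0 scalerA mulrC.
Qed.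

(** If [r m0 = a m] with [m = s m0], then [r - s a] kills the generator [m0], hence all of [M], and
    [r = s a + (r - s a)]. *)
Lemma cyclic_colon_mul_elt M (a : R) : cyclic_module M ->
  colon (@mul_elt R M a) = @principal_plus_ann R M a.
Proof.
move=> [m0 Mm0]; have genM m : exists s, s *: m0 = m.
  by have : setT m by []; rewrite Mm0 => -[s _ <-]; exists s.
apply/seteqP; split=> [r ram|]; last exact: principal_plus_ann_sub_colon.
have [m _ mE] := ram m0; have [s sE] := genM m.
exists (s * a); first by exists s.
exists (r - s * a); last by rewrite subrKC.
move=> x _; have [t <-] := genM x.
by rewrite scalerA mulrC -scalerA scalerBl -mE -sE scalerA [s * a]mulrC subrr
  scaler0.
Qed.

Lemma cyclic_range M (h : {linear M -> M}) :
  cyclic_module M -> cyclic_submodule (range h).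
Proof.
move=> [m0 Mm0]; exists (h m0); apply/seteqP; split=> [_ [m _ <-]|_ [s _ <-]].
  by have : setT m by []; rewrite Mm0 => -[s _ <-]; exists s; rewrite ?linearZ.
by exists (s *: m0); rewrite ?linearZ.
Qed.

Lemma submoduleP M (N : set M) :
  submodule N <-> N 0 /\ forall r x y, N x -> N y -> N (r *: x + y).
Proof.
split=> -[N0 NP]; split.
- exact: set_mem N0.
- by move=> r x y Nx Ny; apply/set_mem/NP; apply/mem_set.
- exact: mem_set N0.
- by move=> r x y /set_mem Nx /set_mem Ny; apply/mem_set/NP.
Qed.

Lemma submodule_image M (h : {linear M -> M}) (N : set M) :
  submodule N -> submodule (h @` N).
Proof.
move=> /submoduleP [N0 NP]; apply/submoduleP; split.
  by exists 0; rewrite ?linear0.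
move=> r _ _ [x Nx <-] [y Ny <-]; exists (r *: x + y); rewrite ?linearP //.
exact: NP.
Qed.

Lemma submodule_preimage0 M (h : {linear M -> M}) :
  submodule (h @^-1` [set 0]).
Proof.
apply/submoduleP; split=> [|r x y /= hx hy]; first exact: linear0.
by rewrite linearP hx hy scaler0 addr0.
Qed.

Lemma submoduleI M (N P : set M) :
  submodule N -> submodule P -> submodule (N `&` P).
Proof.
move=> /submoduleP [N0 NP] /submoduleP [P0 PP]; apply/submoduleP; split=> //.
by move=> r x y [Nx Px] [Ny Py]; split; [exact: NP|exact: PP].
Qed.

(** The socle meets [N] nontrivially because it is essential; being simple, it equals that
    intersection. *)
Lemma cocyclic_socle_sub M (N : set M) :
  cocyclic M -> submodule N -> N <> [set 0] -> @socle R M `<=` N.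
Proof.
move=> [[Ssub _ Ssimple] [_ Sess]] Nsub N0.
have SN : @socle R M `&` N `<=` @socle R M by move=> x [].
case: (Ssimple _ (submoduleI Ssub Nsub) SN) => [/(Sess _ Nsub N0)//|<-].
by move=> x [].
Qed.

Lemma cocyclic_ker_completely_irreducible M (h : {linear M -> M}) :
  cocyclic M -> h @^-1` [set 0] <> setT ->
  completely_irreducible (h @^-1` [set 0]).
Proof.
move=> Mco hT; split=> // [|J N_ Nsub kerE]; first exact: submodule_preimage0.
have [Ssub Sn0 _] := Mco.1; have [S0 _] := (submoduleP _).1 Ssub.
apply: contrapT => /forallNP Nne.
have kerN j : h @^-1` [set 0] `<=` N_ j by rewrite kerE => x; exact.
(* If [h] vanished on [N_ j], then [N_ j] would be contained in the kernel and so equal to it,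
   against [Nne]. *)
have SN j : @socle R M `<=` h @` N_ j.
  apply: cocyclic_socle_sub => // [|hN0]; first exact: submodule_image.
  apply: (Nne j); apply/seteqP; split=> [|x Nx]; first exact: kerN.
  by have : (h @` N_ j) (h x) by [exists x]; rewrite hN0.
(* An empty family would have intersection [M], whereas the kernel is proper. *)
have [j0 _] : exists j : J, True.
  apply: contrapT => /forallNP NJ; apply: hT; rewrite kerE.
  by apply/seteqP; split=> // x _ j; case: (NJ j).
(* The contradiction is that the socle vanishes: each [s] in it is [h x] with [x] in [N_ j0], and
   [x] turns out to lie in the kernel. *)
apply: Sn0; apply/seteqP; split=> [s Ss|_ -> //].
have [x _ xs] := SN j0 s Ss; rewrite -xs.
suff : (h @^-1` [set 0]) x by [].
(* Two preimages of [s] differ by an element of the kernel, which lies in [N_ j]; so [x] is in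
   [N_ j] along with [y]. *)
rewrite kerE => j _; have [y Ny ys] := SN j s Ss.
have Nxy : N_ j (x - y) by apply: kerN; rewrite /= linearB xs ys subrr.
have [_ NP] := (submoduleP _).1 (Nsub j).
by have := NP 1 _ _ Nxy Ny; rewrite scale1r subrK.
Qed.

(** This is the double annihilator condition for the ideal [Ra], since [Ra] and [a] annihilate the
    same elements of [M]. *)
Lemma dac_ann_colon0_elt M (a : R) : dac M ->
  ann (@colon0_elt R M a) = range (fun r : R => r * a).
Proof.
move=> Mdac.
have Ra_ideal : ideal (range (fun r : R => r * a)).
  apply/(@submoduleP R^o); split; first by exists 0; rewrite ?mul0r.
  move=> r _ _ [s _ <-] [t _ <-]; exists (r * s + t) => //.
  by rewrite mulrDl -mulrA.
rewrite [RHS](Mdac _ Ra_ideal); congr ann; apply/seteqP; split=> m /= am.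
  by move=> _ [r _ <-]; rewrite -scalerA am scaler0.
by apply: am; exists 1; rewrite ?mul1r.
Qed.

End Modules.

Theorem proposition2p23 (R : comPzRingType) :
  (forall M : lmodType R,
      cyclic_module M -> morphic M -> quasi_morphic M) /\
  (forall M : lmodType R,
      cocyclic M -> dac M -> morphic M -> quasi_comorphic M).
Proof.
split=> [M Mcyc Mmor a|M Mco Mdac Mmor a]; split.
- have [h [_ <-]] := morphic_scale a Mmor.
  exact: cyclic_range.
- by rewrite morphic_ann_colon0_elt // cyclic_colon_mul_elt.
- have [h [<- _]] := morphic_scale a Mmor.
  have [->|hT] := pselect (h @^-1` [set 0] = setT); first by left.
  by right; exact: cocyclic_ker_completely_irreducible.
- apply/seteqP; split; last exact: principal_plus_ann_sub_colon.
  (* Here [(aM :_R M) = Ann (0 :_M a) = Ra], so the summand from [Ann M] is taken to be [0]. *)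
  rewrite -morphic_ann_colon0_elt // dac_ann_colon0_elt // => r Rar.
  by exists r => //; exists 0; rewrite ?addr0 // => m _; rewrite scale0r.
Qed.
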